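(* Let $M$ be a smooth $n$-dimensional manifold, $\nabla$ an affine connection on $M$, and $h$ a non-degenerate $(0,2)$-tensor field on $M$. Let $(\check h,\hat\nabla)$ be the generalized structure on $TM\oplus T^*M$ induced by $(h,\nabla)$, where $$\check h(X+\eta,Y+\beta)=h(X,Y)+h(h^{-1}(\eta),h^{-1}(\beta)),\qquad \hat\nabla_{X+\eta}(Y+\beta)=\nabla_XY+h(\nabla_X(h^{-1}(\beta))),$$ let $$\hat\nabla^*_{X+\eta}(Y+\beta)=h^{-1}(\nabla_X(h(Y)))+\nabla_X\beta,$$ and for $\alpha\in\mathbb{R}$ let $\hat\nabla^{(\alpha)}=\frac{1+\alpha}{2}\hat\nabla+\frac{1-\alpha}{2}\hat\nabla^*$ be the $\alpha$-connection defined by $(\hat\nabla,\hat\nabla^* )$. Let $\{E_i\}_{1\le i\le n}$ be an orthonormal frame field on $M$ with respect to $h$. If $h$ is symmetric, then the Ricci curvature of $\hat\nabla^{(\alpha)}$ is given by $$\operatorname{Ric}^{\hat\nabla^{(\alpha)}}(Y+\beta,Z+\gamma)=\left(\frac{1+\alpha}{2}\right)^2\operatorname{Ric}^{\nabla}(Y,Z)+\left(\frac{1-\alpha}{2}\right)^2\sum_{i=1}^n(R^{\nabla}(E_i,Y)(h(Z)))(E_i)$$ $$+\frac{1-\alpha^2}{4}\sum_{i=1}^n\{(\nabla_{[Y,E_i]}(h(Z)))(E_i)-(\nabla_Y(h(\nabla_{E_i}Z)))(E_i)+(\nabla_{E_i}(h(\nabla_YZ)))(E_i)$$ $$+h(\nabla_{[Y,E_i]}Z,E_i)-h(\nabla_Y(h^{-1}(\nabla_{E_i}(h(Z)))),E_i)+h(\nabla_{E_i}(h^{-1}(\nabla_Y(h(Z)))),E_i)\},$$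 for all vector fields $Y,Z$ and all $1$-forms $\beta,\gamma$ on $M$.
   Context: The tensor $h$ is identified with the bundle isomorphism $h:TM\to T^*M$, $h(X)=h(X,\cdot)$, with inverse $h^{-1}$. The connection $\nabla$ acts on $1$-forms by $(\nabla_X\beta)(Y)=X(\beta(Y))-\beta(\nabla_XY)$, and $R^\nabla(X,Y)=\nabla_X\nabla_Y-\nabla_Y\nabla_X-\nabla_{[X,Y]}$ on vector fields and on $1$-forms. On $TM\oplus T^*M$ the bracket is $[X+\eta,Y+\beta]_\nabla=[X,Y]+\nabla_X\beta-\nabla_Y\eta$, and the curvature of a connection $D$ is $R^D(\sigma,\tau)\nu=D_\sigma D_\tau\nu-D_\tau D_\sigma\nu-D_{[\sigma,\tau]_\nabla}\nu$. Ricci curvatures are defined by $\operatorname{Ric}^\nabla(Y,Z)=\sum_{i=1}^n h(R^\nabla(E_i,Y)Z,E_i)$ and, using the frame $\{\frac{1}{\sqrt2}(E_i+h(E_i)),\frac1{\sqrt2}(E_i-h(E_i))\}_{1\le i\le n}$, orthonormal with respect to $\check h$, by $$\operatorname{Ric}^{\hat\nabla^{(\alpha)}}(\sigma,\nu)=\frac12\sum_{i=1}^n\{\check h(R^{\hat\nabla^{(\alpha)}}(E_i+h(E_i),\sigma)\nu,E_i+h(E_i))+\check h(R^{\hat\nabla^{(\alpha)}}(E_i-h(E_i),\sigma)\nu,E_i-h(E_i))\}.$$ *)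

(* Defs.v *)
From HB Require Import structures.
From mathcomp Require Import all_boot all_order all_algebra.
From mathcomp Require Import all_classical all_reals all_analysis.
From mathcomp Require Import ring.
Import numFieldNormedType.Exports.
Import Order.TTheory GRing.Theory Num.Theory.

Set Implicit Arguments.
Unset Strict Implicit.
Unset Printing Implicit Defensive.

Local Open Scope classical_set_scope.
Local Open Scope ring_scope.

Section Smoothness.
Context {R : realType} {n : nat}.
Implicit Types (U : set 'rV[R]_n) (f g : 'rV[R]_n -> R).

(* The notion of C^k is the usual one only on an open set U. *)
Fixpoint Ck (k : nat) U f : Prop :=
  if k is k'.+1 then
    (forall x, U x -> differentiable f x) /\
    (forall i : 'I_n, Ck k' U ('D_(delta_mx ord0 i) f))
  else forall x, U x -> f @ x --> f x.

Definition smooth_on U f : Prop := forall k, Ck k U f.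

Lemma near_eq_differentiable f g x :
  (\forall y \near x, f y = g y) -> differentiable f x -> differentiable g x.
Proof.
move=> fg df.
pose e := g - f.
have e0 : \forall h \near 0, e (h + x) = 0.
  have : \forall y \near x, e y = 0.
    by near=> y; rewrite /e !fctE (near fg y)// subrr.
  by rewrite (near_shift 0); apply: filterS => h /=; rewrite subr0.
have ex : e x = 0 by rewrite /e !fctE (nbhs_singleton fg) subrr.
suff de : differentiable e x.
  have -> : g = e + f by rewrite subrK.
  exact: differentiableD.
have oe : e \o shift x = cst (e x) + (\0 : 'rV[R]_n -> R) +o_ 0 id.
  apply/eqaddoP => _/posnumP[eps]; near=> h.
  rewrite /= !fctE /= ex (near e0 h)// /cst addr0 subrr normr0.
  by rewrite mulr_ge0.
have e'0 : 'd e x = \0 :> ('rV[R]_n -> R).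
  by apply: (@diff_unique _ _ _ e \0 x) => //; exact: cst_continuous.
by apply/diff_locallyP; split; rewrite e'0 //; exact: cst_continuous.
Unshelve. all: by end_near. Qed.

Lemma eq_Ck k U f g : open U -> {in U, f =1 g} -> Ck k U f -> Ck k U g.
Proof.
move=> oU; elim: k f g => [|k IH] f g fg;
  have nfg x : U x -> \forall y \near x, f y = g y by
    move=> Ux; apply: filterS (open_nbhs_nbhs (conj oU Ux)) => y Uy;
    rewrite fg ?inE.
  move=> fc x Ux; rewrite -(fg x) ?inE//.
  exact: cvg_trans (near_eq_cvg (nfg x Ux)) (fc x Ux).
move=> [df Df]; split=> [x Ux|i].
  exact: near_eq_differentiable (nfg x Ux) (df x Ux).
apply: IH (Df i) => x; rewrite inE => Ux.
by apply: near_eq_derive; exact: nfg.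
Qed.

Lemma Ck_continuous k U f : Ck k U f -> forall x, U x -> f @ x --> f x.
Proof.
case: k => [|k] fk x Ux; first exact: fk.
have [df _] := fk; exact: differentiable_continuous (df x Ux).
Qed.

Lemma CkW k U f : Ck k.+1 U f -> Ck k U f.
Proof.
elim: k f => [|k IH] f fk; first exact: (@Ck_continuous 1).
have [df Df] := fk; split=> // i; exact: IH (Df i).
Qed.

Lemma Ck_cst k U (a : R) : open U -> Ck k U (cst a).
Proof.
move=> oU; elim: k a => [|k IH] a /=; first by move=> x _; exact: cst_continuous.
split=> [x _|i]; first exact: differentiable_cst.
by apply: eq_Ck (IH 0) => // x _; rewrite /= derive_cst.
Qed.

Lemma CkD k U f g : open U -> Ck k U f -> Ck k U g -> Ck k U (f + g).
Proof.
move=> oU; elim: k f g => [|k IH] f g /=.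
  by move=> fc gc x Ux; exact: (cvgD (fc x Ux) (gc x Ux)).
move=> [df Df] [dg Dg]; split=> [x Ux|i].
  by apply: differentiableD; [exact: df|exact: dg].
apply: eq_Ck (IH _ _ (Df i) (Dg i)) => // x; rewrite inE => Ux.
by rewrite deriveD//; apply: diff_derivable; [exact: df|exact: dg].
Qed.

Lemma CkM k U f g : open U -> Ck k U f -> Ck k U g -> Ck k U (f * g).
Proof.
move=> oU; elim: k f g => [|k IH] f g.
  by move=> fc gc x Ux; exact: (cvgM (fc x Ux) (gc x Ux)).
move=> fk gk; have [df Df] := fk; have [dg Dg] := gk; split=> [x Ux|i].
  by apply: differentiableM; [exact: df|exact: dg].
apply: eq_Ck (CkD oU (IH _ _ (CkW fk) (Dg i)) (IH _ _ (CkW gk) (Df i))) => // x.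
rewrite inE => Ux.
by rewrite deriveM//; apply: diff_derivable; [exact: df|exact: dg].
Qed.

End Smoothness.

Record chart (R : realType) (n : nat) (T : topologicalType) := Chart {
  chart_dom : set T;
  chart_map : T -> 'rV[R]_n;
  chart_inv : 'rV[R]_n -> T;
  chart_dom_open : open chart_dom;
  chart_img_open : open (chart_map @` chart_dom);
  chart_mapK : {in chart_dom, cancel chart_map chart_inv};
  chart_map_continuous : {in chart_dom, continuous chart_map};
  chart_inv_continuous :
    {in chart_map @` chart_dom, continuous chart_inv}
}.

Definition chart_img R n T (c : chart R n T) : set 'rV[R]_n :=
  chart_map c @` chart_dom c.

Record smoothManifold (R : realType) (n : nat) := SmoothManifold {
  mfd_space :> topologicalType;
  mfd_hausdorff : hausdorff_space mfd_space;
  mfd_second_countable : @second_countable mfd_space;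
  atlas : set (chart R n mfd_space);
  atlas_cover : forall p, exists2 c, atlas c & chart_dom c p;
  atlas_compatible : forall c d, atlas c -> atlas d -> forall j : 'I_n,
    smooth_on (chart_map c @` (chart_dom c `&` chart_dom d))
              (fun x => chart_map d (chart_inv c x) ord0 j)
}.

Section SmoothFunctions.
Context {R : realType} {n : nat} (M : smoothManifold R n).

Definition smooth (f : M -> R) : Prop :=
  forall c, atlas c -> smooth_on (chart_img c) (f \o chart_inv c).

Definition smooth_pred : {pred M -> R} := fun f => `[< smooth f >].

Lemma smooth_cst (a : R) : smooth (cst a).
Proof. by move=> c _ k; apply: Ck_cst; exact: chart_img_open. Qed.

Lemma smoothD f g : smooth f -> smooth g -> smooth (f + g).
Proof.
move=> fs gs c cA k.
exact: (CkD (@chart_img_open _ _ _ c) (fs c cA k) (gs c cA k)).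
Qed.

Lemma smoothM f g : smooth f -> smooth g -> smooth (f * g).
Proof.
move=> fs gs c cA k.
exact: (CkM (@chart_img_open _ _ _ c) (fs c cA k) (gs c cA k)).
Qed.

Lemma smooth_subring_closed : subring_closed smooth_pred.
Proof.
split=> [|f g /asboolP fs /asboolP gs|f g /asboolP fs /asboolP gs].
- by apply/asboolP; exact: smooth_cst.
- apply/asboolP.
  have -> : f - g = f + cst (- 1) * g.
    by apply/funext => p; rewrite !fctE /= mulN1r.
  by apply: smoothD => //; apply: smoothM => //; exact: smooth_cst.
- by apply/asboolP; exact: smoothM.
Qed.

HB.instance Definition _ :=
  GRing.isSubringClosed.Build (M -> R) smooth_pred smooth_subring_closed.
Record smoothFun := SmoothFun {
  smoothFun_fun :> M -> R;
  smoothFunP : smooth_pred smoothFun_fun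
}.

HB.instance Definition _ := [isSub for smoothFun_fun].
HB.instance Definition _ := [Choice of smoothFun by <:].
HB.instance Definition _ := 
  GRing.SubChoice_isSubComPzRing.Build (M -> R) smooth_pred smoothFun
    (GRing.subringClosedP _).

Definition constf (a : R) : smoothFun := SmoothFun (asboolT (smooth_cst a)).

End SmoothFunctions.

Section Fields.
Context {R : realType} {n : nat} (M : smoothManifold R n).
Local Notation C := (smoothFun M).

(* Tangent vectors at p are the derivations of C^oo(M) at p. *)
Definition is_tangent_vector (p : M) (v : C -> R) : Prop :=
  [/\ forall (a b : R) (f g : C),
        v (constf M a * f + constf M b * g) = a * v f + b * v g
    & forall f g : C, v (f * g) = f p * v g + g p * v f].

(* Vector fields are the derivations of C^oo(M); the value at p of X is the
   tangent vector f |-> X f p. *)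
Definition derivation (D : C -> C) : Prop :=
  [/\ forall f g, D (f + g) = D f + D g,
      forall a f, D (constf M a * f) = constf M a * D f
    & forall f g, D (f * g) = f * D g + g * D f].

Record vfield := VField {
  vfield_fun :> C -> C;
  vfieldP : derivation vfield_fun
}.

Lemma vfieldD (X : vfield) f g : X (f + g) = X f + X g.
Proof. by case: (vfieldP X). Qed.

Lemma vfieldZ (X : vfield) a f : X (constf M a * f) = constf M a * X f.
Proof. by case: (vfieldP X). Qed.

Lemma vfieldM (X : vfield) f g : X (f * g) = f * X g + g * X f.
Proof. by case: (vfieldP X). Qed.

Lemma vfield_eq (X Y : vfield) : (forall f, X f = Y f) -> X = Y.
Proof.
case: X Y => [X XP] [Y YP] /= /funext XY; subst Y.
by congr VField; exact: Prop_irrelevance.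
Qed.

HB.instance Definition _ := gen_eqMixin vfield.
HB.instance Definition _ := gen_choiceMixin vfield.

Lemma derivation_zero : derivation (fun=> 0).
Proof. by split=> *; rewrite ?mulr0 ?addr0. Qed.

Lemma derivation_opp (X : vfield) : derivation (fun f => - X f).
Proof.
by split=> *; rewrite ?vfieldD ?vfieldZ ?vfieldM ?opprD ?mulrN.
Qed.

Lemma derivation_add (X Y : vfield) : derivation (fun f => X f + Y f).
Proof.
split=> *; rewrite ?vfieldD ?vfieldZ ?vfieldM ?mulrDr//; exact: addrACA.
Qed.

Lemma derivation_scale (u : C) (X : vfield) : derivation (fun f => u * X f).
Proof.
split=> [f g|a f|f g]; rewrite ?vfieldD ?vfieldZ ?vfieldM ?mulrDr//.
  exact: mulrCA.
by congr (_ + _); exact: mulrCA.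
Qed.

Lemma derivation_lie (X Y : vfield) : derivation (fun f => X (Y f) - Y (X f)).
Proof.
split=> [f g|a f|f g].
- by rewrite !vfieldD opprD addrACA.
- by rewrite !vfieldZ mulrBr.
- rewrite !(vfieldM, vfieldD).
  ring.
Qed.

Definition vfield_zero := VField derivation_zero.
Definition vfield_opp X := VField (derivation_opp X).
Definition vfield_add X Y := VField (derivation_add X Y).
Definition vfield_scale u X := VField (derivation_scale u X).
Definition lie X Y := VField (derivation_lie X Y).

Lemma vfield_addA : associative vfield_add.
Proof. by move=> X Y Z; apply: vfield_eq => f; exact: addrA. Qed.

Lemma vfield_addC : commutative vfield_add.
Proof. by move=> X Y; apply: vfield_eq => f; exact: addrC. Qed.

Lemma vfield_add0 : left_id vfield_zero vfield_add.
Proof. by move=> X; apply: vfield_eq => f; exact: add0r. Qed.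

Lemma vfield_addN : left_inverse vfield_zero vfield_opp vfield_add.
Proof. by move=> X; apply: vfield_eq => f; exact: addNr. Qed.

HB.instance Definition _ := GRing.isZmodule.Build vfield
  vfield_addA vfield_addC vfield_add0 vfield_addN.

Lemma vfield_scaleA (u w : C) X :
  vfield_scale u (vfield_scale w X) = vfield_scale (u * w) X.
Proof. by apply: vfield_eq => f; exact: mulrA. Qed.

Lemma vfield_scale1 : left_id 1 vfield_scale.
Proof. by move=> X; apply: vfield_eq => f; exact: mul1r. Qed.

Lemma vfield_scaleDr : right_distributive vfield_scale +%R.
Proof. by move=> u X Y; apply: vfield_eq => f; exact: mulrDr. Qed.

Lemma vfield_scaleDl X :
  {morph vfield_scale^~ X : u w / u + w >-> u + w}.
Proof. by move=> u w; apply: vfield_eq => f; exact: mulrDl. Qed.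

HB.instance Definition _ := GRing.Zmodule_isLmodule.Build C vfield
  vfield_scaleA vfield_scale1 vfield_scaleDr vfield_scaleDl.

(* 1-forms are the C^oo(M)-linear functionals on vector fields. *)
Definition function_linear (w : vfield -> C) : Prop :=
  (forall X Y, w (X + Y) = w X + w Y) /\ (forall u X, w (u *: X) = u * w X).

Record one_form := OneForm {
  one_form_fun :> vfield -> C;
  one_formP : function_linear one_form_fun
}.

Lemma one_formD (w : one_form) X Y : w (X + Y) = w X + w Y.
Proof. by case: (one_formP w). Qed.

Lemma one_formZ (w : one_form) u X : w (u *: X) = u * w X.
Proof. by case: (one_formP w). Qed.

Lemma one_form_eq (w z : one_form) : (forall X, w X = z X) -> w = z.
Proof.
case: w z => [w wP] [z zP] /= /funext wz; subst z.
by congr OneForm; exact: Prop_irrelevance.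
Qed.

HB.instance Definition _ := gen_eqMixin one_form.
HB.instance Definition _ := gen_choiceMixin one_form.

Lemma function_linear_zero : function_linear (fun=> 0).
Proof. by split=> *; rewrite ?mulr0 ?addr0. Qed.

Lemma function_linear_opp (w : one_form) : function_linear (fun X => - w X).
Proof. by split=> *; rewrite ?one_formD ?one_formZ ?opprD ?mulrN. Qed.

Lemma function_linear_add (w z : one_form) :
  function_linear (fun X => w X + z X).
Proof. by split=> *; rewrite ?one_formD ?one_formZ ?mulrDr//; exact: addrACA. Qed.

Lemma function_linear_scale (u : C) (w : one_form) :
  function_linear (fun X => u * w X).
Proof.
by split=> *; rewrite ?one_formD ?one_formZ ?mulrDr//; exact: mulrCA.
Qed.

Definition one_form_zero := OneForm function_linear_zero.
Definition one_form_opp w := OneForm (function_linear_opp w).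
Definition one_form_add w z := OneForm (function_linear_add w z).
Definition one_form_scale u w := OneForm (function_linear_scale u w).

Lemma one_form_addA : associative one_form_add.
Proof. by move=> w z t; apply: one_form_eq => X; exact: addrA. Qed.

Lemma one_form_addC : commutative one_form_add.
Proof. by move=> w z; apply: one_form_eq => X; exact: addrC. Qed.

Lemma one_form_add0 : left_id one_form_zero one_form_add.
Proof. by move=> w; apply: one_form_eq => X; exact: add0r. Qed.

Lemma one_form_addN : left_inverse one_form_zero one_form_opp one_form_add.
Proof. by move=> w; apply: one_form_eq => X; exact: addNr. Qed.

HB.instance Definition _ := GRing.isZmodule.Build one_form
  one_form_addA one_form_addC one_form_add0 one_form_addN.

Lemma one_form_scaleA (u v : C) w :
  one_form_scale u (one_form_scale v w) = one_form_scale (u * v) w.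
Proof. by apply: one_form_eq => X; exact: mulrA. Qed.

Lemma one_form_scale1 : left_id 1 one_form_scale.
Proof. by move=> w; apply: one_form_eq => X; exact: mul1r. Qed.

Lemma one_form_scaleDr : right_distributive one_form_scale +%R.
Proof. by move=> u w z; apply: one_form_eq => X; exact: mulrDr. Qed.

Lemma one_form_scaleDl w : {morph one_form_scale^~ w : u v / u + v >-> u + v}.
Proof. by move=> u v; apply: one_form_eq => X; exact: mulrDl. Qed.

HB.instance Definition _ := GRing.Zmodule_isLmodule.Build C one_form
  one_form_scaleA one_form_scale1 one_form_scaleDr one_form_scaleDl.

(* (0,2)-tensor fields are the C^oo(M)-bilinear maps on vector fields. *)
Record tensor02 := Tensor02 {
  tensor02_fun :> vfield -> vfield -> C;
  tensor02_linearl : forall Y, function_linear (tensor02_fun^~ Y);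
  tensor02_linearr : forall X, function_linear (tensor02_fun X)
}.

Definition tensor_symmetric (h : tensor02) : Prop :=
  forall X Y, h X Y = h Y X.

(* h X Y p depends only on the values of X and Y at p: this says that each
   bilinear form h_p on T_pM has trivial kernel. *)
Definition tensor_nondegenerate (h : tensor02) : Prop :=
  forall (p : M) (X : vfield),
    (forall Y, h X Y p = 0) -> forall f, X f p = 0.

(* h : TM -> T*M and its inverse. *)
Definition flat (h : tensor02) (X : vfield) : one_form :=
  OneForm (tensor02_linearr h X).

(* When h is non-degenerate, sharp h w is the only X such that flat h X = w. *)
Definition sharp (h : tensor02) (w : one_form) : vfield :=
  xget 0 [set X | flat h X = w].

Record affine_connection := AffineConnection {
  connection_fun :> vfield -> vfield -> vfield;
  connectionDl : forall X X' Y,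
    connection_fun (X + X') Y = connection_fun X Y + connection_fun X' Y;
  connectionZl : forall u X Y,
    connection_fun (u *: X) Y = u *: connection_fun X Y;
  connectionDr : forall X Y Y',
    connection_fun X (Y + Y') = connection_fun X Y + connection_fun X Y';
  connectionZr : forall X u Y,
    connection_fun X (u *: Y) = X u *: Y + u *: connection_fun X Y
}.

Lemma function_linear_connection (nabla : affine_connection) (X : vfield)
    (w : one_form) :
  function_linear (fun Y => X (w Y) - w (nabla X Y)).
Proof.
split=> [Y Z|u Y].
  by rewrite connectionDr !one_formD vfieldD opprD addrACA.
rewrite connectionZr !one_formD !one_formZ vfieldM.
ring.
Qed.

Definition nablaF (nabla : affine_connection) (X : vfield) (w : one_form) :
    one_form :=
  OneForm (function_linear_connection nabla X w).

(* The common shape of the curvatures of nabla on vector fields, of nabla on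
   1-forms, and of a connection on TM + T*M. *)
Definition curvature (S : Type) (V : zmodType) (bracket : S -> S -> S)
    (D : S -> V -> V) (s t : S) (v : V) : V :=
  D s (D t v) - D t (D s v) - D (bracket s t) v.

Definition curv (nabla : affine_connection) := curvature lie nabla.

Definition curvF (nabla : affine_connection) := curvature lie (nablaF nabla).

(* Sections X + w of TM + T*M, as pairs (X, w). *)
Definition gsection := (vfield * one_form)%type.

Definition gbracket (nabla : affine_connection) (s t : gsection) : gsection :=
  (lie s.1 t.1, nablaF nabla s.1 t.2 - nablaF nabla t.1 s.2).

Definition gmetric (h : tensor02) (s t : gsection) : C :=
  h s.1 t.1 + h (sharp h s.2) (sharp h t.2).

Definition gconn (h : tensor02) (nabla : affine_connection)
    (s t : gsection) : gsection :=
  (nabla s.1 t.1, flat h (nabla s.1 (sharp h t.2))).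

Definition gconn_dual (h : tensor02) (nabla : affine_connection)
    (s t : gsection) : gsection :=
  (sharp h (nablaF nabla s.1 (flat h t.1)), nablaF nabla s.1 t.2).

Definition alpha_conn (a : R) (D D' : gsection -> gsection -> gsection)
    (s t : gsection) : gsection :=
  constf M ((1 + a) / 2) *: D s t + constf M ((1 - a) / 2) *: D' s t.

Definition gcurv (nabla : affine_connection)
    (D : gsection -> gsection -> gsection) := curvature (gbracket nabla) D.

Definition ricci (h : tensor02) (nabla : affine_connection)
    (E : 'I_n -> vfield) (Y Z : vfield) : C :=
  \sum_(i < n) h (curv nabla (E i) Y Z) (E i).

Definition gricci (h : tensor02) (nabla : affine_connection)
    (D : gsection -> gsection -> gsection) (E : 'I_n -> vfield)
    (s v : gsection) : C :=
  let P i : gsection := (E i, flat h (E i)) in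
  let N i : gsection := (E i, - flat h (E i)) in
  constf M 2^-1 * \sum_(i < n)
    (gmetric h (gcurv nabla D (P i) s v) (P i) +
     gmetric h (gcurv nabla D (N i) s v) (N i)).

(* The values at q of the E i form a basis of T_qM. *)
Definition is_frame_at (E : 'I_n -> vfield) (q : M) : Prop :=
  forall v, is_tangent_vector q v ->
    exists! c : 'rV[R]_n, forall f, v f = \sum_(i < n) c ord0 i * E i f q.

(* h may be indefinite: orthonormal means h(E_i, E_j) = +-delta_ij. *)
Definition orthonormal_at (h : tensor02) (E : 'I_n -> vfield) (q : M) : Prop :=
  forall i j, `|h (E i) (E j) q| = (i == j)%:R.

(* M need not be parallelizable, so a frame field on M is a family of local
   ones: the fields E p i are a frame near p (every local frame agrees near p
   with such global fields). A global frame is a constant family. *)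
Definition orthonormal_frame_field (h : tensor02)
    (E : M -> 'I_n -> vfield) : Prop :=
  forall p, \forall q \near p,
    is_frame_at (E p) q /\ orthonormal_at h (E p) q.

End Fields.

(* Main.v *)
Require Import Defs.
From HB Require Import structures.
From mathcomp Require Import all_boot all_order all_algebra.
From mathcomp Require Import all_classical all_reals all_analysis.
From mathcomp Require Import ring.
Import numFieldNormedType.Exports.
Import Order.TTheory GRing.Theory Num.Theory.

Set Implicit Arguments.
Unset Strict Implicit.
Unset Printing Implicit Defensive.

Local Open Scope classical_set_scope.
Local Open Scope ring_scope.

(* The connection nabla^(alpha) acts on vector fields by
   D_X Z = a nabla_X Z + b h^-1(nabla_X (h Z)),
   with a = (1+alpha)/2 and b = (1-alpha)/2, and on forms separately, so the two
   halves of the frame of TM + T*M keep only h(R^D(E_i, Y)Z, E_i). Expanding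
   R^D, and splitting the bracket term by a = a^2 + ab, b = b^2 + ab, gives the
   formula.
   This uses that the flat map onto all C^oo-linear functionals is invertible.
   The inverse is glued from the local formulas
   sum_j h(E_j, E_j) w(E_j) E_j, which agree where they overlap because a
   C^oo-linear functional only depends on point values; the latter follows from
   bump functions and Cramer's rule in a local frame. *)

(** * Bump functions *)

Section FlatFunction.
Context {R : realType}.
Implicit Types (P : {poly R}) (t s : R).

(** The polynomial factor makes the family stable under derivation, so smoothness of e^(-1/t), the
    case [P = 1], follows by an induction over all [P] at once. *)
Definition flat_exp P t : R := if 0 < t then P.[t^-1] * expR (- t^-1) else 0.

(** The exponential series gives s^m <= m! e^s, which is applied to each monomial. *)
Lemma norm_poly_le_expR P :
  exists C, forall s, 0 <= s -> `|P.[s]| <= C * expR s.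
Proof.
exists (\sum_(i < size P) `|P`_i| * i`!%:R) => s s0.
rewrite horner_coef mulr_suml; apply: le_trans (ler_norm_sum _ _ _) _.
apply: ler_sum => i _; rewrite normrM -mulrA ler_wpM2l//.
rewrite ger0_norm ?exprn_ge0//.
case: (nat_of_ord i) => [|m].
  by rewrite expr0 fact0 mul1r -expR0 ler_expR.
rewrite mulrC -ler_pdivrMr ?ltr0n ?fact_gt0//.
by apply: le_trans (expR_ge1Dxn m s0); rewrite lerDr.
Qed.

(** This is the previous bound for [P * 'X^2] at s = 1/t. Being quadratic in [t], it forces the
    derivative at 0 to vanish. *)
Lemma flat_exp_le P : exists C, forall t, `|flat_exp P t| <= C * t ^+ 2.
Proof.
have [C HC] := norm_poly_le_expR (P * 'X^2).
exists C => t; rewrite /flat_exp; case: ifPn => [t0|_]; last first.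
  have C0 : 0 <= C.
    by have := HC 0 (lexx _); rewrite expR0 mulr1; apply: le_trans.
  by rewrite normr0 mulr_ge0// sqr_ge0.
have := HC t^-1; rewrite invr_ge0 ltW// => /(_ isT).
rewrite hornerM hornerXn !normrM (ger0_norm (expR_ge0 _)).
rewrite (ger0_norm (ltW (_ : 0 < t^-1))) ?invr_gt0// -expr2 => H.
rewrite expRN ler_pdivrMr ?expR_gt0// mulrAC -ler_pdivrMr ?exprn_gt0//.
by rewrite -exprVn.
Qed.

Lemma is_derive_flat_exp P t :
  is_derive t (1 : R) (flat_exp P) (flat_exp ((P - P^`()) * 'X^2) t).
Proof.
have [t0|t0|<-] := ltgtP 0 t.
- apply: (@near_eq_is_derive _ _ _
    ((horner P \o GRing.inv) * (expR \o (-%R \o GRing.inv)))).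
    near=> y; rewrite !fctE /flat_exp ifT//.
    by near: y; exact: lt_nbhsr.
  have dV : is_derive t (1 : R) GRing.inv (- t ^- 2).
    apply: DeriveDef; first by apply: derivableV => //; rewrite gt_eqF.
    by rewrite deriveV ?gt_eqF// derive_id scaler1.
  apply: is_derive_eq.
  rewrite /flat_exp t0 /= hornerM hornerD hornerN hornerXn -exprVn.
  rewrite /GRing.scale/=.
  ring.
- apply: (@near_eq_is_derive _ _ _ (cst 0)).
    near=> y; rewrite /= /flat_exp ifF//.
    apply/negbTE; rewrite -leNgt ltW//.
    by near: y; exact: lt_nbhsl.
  by rewrite /flat_exp ltNge ltW//=; exact: is_derive_cst.
(* At [t = 0] the difference quotient is bounded by [C] times |h|, which tends to 0. *)
have [C HC] := flat_exp_le P.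
rewrite [flat_exp (_ * _) _]/flat_exp ltxx.
suff d0 : (fun h : R =>
    h^-1 *: ((flat_exp P \o shift 0) (h *: 1) - flat_exp P 0))
    @ 0^' --> (0 : R).
  by apply: DeriveDef; [apply/cvg_ex; exists 0|exact: cvg_lim d0].
apply/cvgr0Pnorm_le => e e0; near=> h.
have h0 : h != 0 by near: h; exact: nbhs_dnbhs_neq.
rewrite /= {2}/flat_exp ltxx addr0 subr0 [_%:A]mulr1 normrM.
rewrite normfV mulrC ler_pdivrMr ?normr_gt0//.
apply: le_trans (HC h) _; rewrite -real_normK ?num_real// expr2 mulrA.
rewrite ler_wpM2r//.
(* The [+ 1] keeps the denominator positive even if [C] is 0. *)
have : `|h| < e / (`|C| + 1).
  near: h; apply: dnbhs0_lt; rewrite divr_gt0// ltr_wpDl//.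
rewrite ltr_pdivlMr ?ltr_wpDl// => /ltW; apply: le_trans.
rewrite mulrC ler_wpM2l// (le_trans (ler_norm _))// lerDl//.
Unshelve. all: by end_near. Qed.
End FlatFunction.

(** * C^k functions: locality and composition with flat functions *)

Section CkTheory.
Context {R : realType} {n : nat}.
Implicit Types (U V : set 'rV[R]_n) (f g : 'rV[R]_n -> R).

(** Each clause of [Ck] is a condition at one point of the set, and the partial derivatives are
    those of [f] itself rather than of a restriction. *)
Lemma Ck_nbhs k U f :
  (forall x, U x -> exists2 V, V x & Ck k V f) -> Ck k U f.
Proof.
elim: k f => [|k IH] f H; first by move=> x /H[V Vx]; apply.
split=> [x /H[V Vx []]|i]; first by move=> + _; apply.
by apply: IH => x /H[V Vx [_ DV]]; exists V; last exact: DV.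
Qed.

Lemma Ck_flat_exp k U (P : {poly R}) f :
  open U -> Ck k U f -> Ck k U (flat_exp P \o f).
Proof.
move=> oU; elim: k P f => [|k IH] P f fk.
  move=> x Ux; apply: continuous_comp; first exact: fk.
  apply: differentiable_continuous; apply/derivable1_diffP.
  exact: (@ex_derive _ _ _ _ _ _ _ (is_derive_flat_exp P (f x))).
have [df Df] := fk.
have dP t : differentiable (flat_exp P) t.
  apply/derivable1_diffP.
  exact: (@ex_derive _ _ _ _ _ _ _ (is_derive_flat_exp P t)).
split=> [x Ux|i]; first exact: differentiable_comp (df x Ux) (dP _).
apply: eq_Ck (CkM oU (IH ((P - P^`()) * 'X^2) _ (CkW fk)) (Df i)) => // x.
rewrite inE => Ux.
rewrite [RHS]deriveE; last exact: differentiable_comp (df x Ux) (dP _).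
rewrite (diff_comp (df x Ux) (dP _)).
rewrite /= -(deriveE _ (df x Ux)).
rewrite deriv1E; last exact/derivable1_diffP.
rewrite derive1E (@derive_val _ _ _ _ _ _ _ (is_derive_flat_exp P _)).
by rewrite [RHS]mulrC.
Qed.

Lemma Ck_sum k U (I : Type) (r : seq I) (f : I -> 'rV[R]_n -> R) :
  open U -> (forall i, Ck k U (f i)) -> Ck k U (\sum_(i <- r) f i).
Proof.
move=> oU fk; elim/big_rec : _ => [|i g _ gk]; first exact: Ck_cst.
exact: CkD.
Qed.

End CkTheory.

(** * Cut-off functions on the manifold *)

Section Bump.
Context {R : realType} {n : nat} (M : smoothManifold R n).

Lemma chart_inv_preimage_open (c : chart R n M) (A : set M) :
  open A -> open (chart_img c `&` chart_inv c @^-1` A).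
Proof.
move=> oA; rewrite openE => y [cy Ay]; apply: filterI.
  by apply: open_nbhs_nbhs; split=> //; exact: chart_img_open.
apply: (@chart_inv_continuous _ _ _ c y); first by rewrite inE.
exact: open_nbhs_nbhs.
Qed.

Lemma chart_invP (c : chart R n M) (A : set M) y :
  chart_img c y -> A (chart_inv c y) ->
  (chart_map c @` (chart_dom c `&` A)) y.
Proof.
by move=> [x cx <-]; rewrite chart_mapK ?inE// => Ax; exists x.
Qed.

(** In a chart, take e^(-1/g) with g = r^2 - |y - y0|^2 where g > 0, and extend by 0. *)
Lemma bump_exists (p : M) (U : set M) : nbhs p U ->
  exists2 phi : smoothFun M, phi p != 0 & forall q, ~ U q -> phi q = 0.
Proof.
move=> pU; have [c cA cp] := atlas_cover p.
have [V [oV Vp] VU] : exists2 V, open_nbhs p V & V `<=` U.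
  by move: pU; rewrite nbhsE.
pose y0 := chart_map c p.
have nV : nbhs y0 (chart_img c `&` chart_inv c @^-1` V).
  apply: open_nbhs_nbhs; split; first exact: chart_inv_preimage_open.
  by split; [exists p|rewrite /= chart_mapK ?inE].
have [r r0 rV] : exists2 r : R, 0 < r &
    forall y : 'rV_n, (forall j, `|y ord0 j - y0 ord0 j| <= r) ->
    chart_img c y /\ V (chart_inv c y).
  have [e /= e0 eV] := (iffLR (nbhs_ballP _ _)) nV.
  (* Half the radius, so that the closed cube fits in the open ball. *)
  exists (e / 2) => [|y Hy]; first by rewrite divr_gt0.
  apply: eV; split=> // i j; rewrite (ord1 i) /ball/= distrC.
  by apply: le_lt_trans (Hy j) _; rewrite ltr_pdivrMr// ltr_pMr// ltr1n.
pose g (y : 'rV[R]_n) := r ^+ 2 - \sum_j (y ord0 j - y0 ord0 j) ^+ 2.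
pose phi (q : M) : R :=
  if `[< chart_dom c q >] then flat_exp 1 (g (chart_map c q)) else 0.
pose box := [set y : 'rV[R]_n |
  forall j, `[y0 ord0 j - r, y0 ord0 j + r]%classic (y ord0 j)].
have boxE y : box y -> forall j, `|y ord0 j - y0 ord0 j| <= r.
  by move=> By j; rewrite ler_distl; have := By j; rewrite /= in_itv.
(* The image of the compact cube is closed because [M] is Hausdorff, so [phi] vanishes on an open
   set containing all points outside the chart. *)
have cK : closed (chart_inv c @` box).
  apply: compact_closed; first exact: mfd_hausdorff.
  apply: continuous_compact.
    apply: continuous_in_subspaceT => y; rewrite inE => /boxE/rV[cy _].
    by apply: chart_inv_continuous; rewrite inE.
  apply: (@rV_compact R n
    (fun j => `[y0 ord0 j - r, y0 ord0 j + r]%classic)) => j.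
  exact: segment_compact.
have phi0 q : ~ (chart_inv c @` box) q -> phi q = 0.
  move=> Kq; rewrite /phi; case: asboolP => // cq.
  rewrite /flat_exp ifF//; apply/negbTE; apply: contra_notN Kq => gq.
  exists (chart_map c q); last by rewrite chart_mapK ?inE.
  move=> j; rewrite /= in_itv/= -ler_distl.
  rewrite -(ler_pXn2r (n:=2))// ?nnegrE ?(ltW r0)// real_normK ?num_real//.
  move: gq; rewrite /g subr_gt0 => /ltW; apply: le_trans.
  by rewrite (bigD1 j)//= lerDl sumr_ge0// => i _; rewrite sqr_ge0.
have sphi : smooth phi.
  move=> d dA k; apply: Ck_nbhs => y dy.
  (* Inside the domain of [c], smoothness comes from the transition map; outside it, [phi] is 0 on
     the open complement of the cube's image. *)
  have [cy|cy] := pselect (chart_dom c (chart_inv d y)).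
    pose W := chart_img d `&` chart_inv d @^-1` chart_dom c.
    have oW : open W by apply: chart_inv_preimage_open; exact: chart_dom_open.
    exists W; first by split.
    have WP z : W z -> (chart_map d @` (chart_dom d `&` chart_dom c)) z.
      by move=> [dz cz]; exact: chart_invP.
    have cj j : Ck k W (fun z => chart_map c (chart_inv d z) ord0 j).
      apply: Ck_nbhs => z Wz.
      exists (chart_map d @` (chart_dom d `&` chart_dom c)).
        exact: WP.
      exact: atlas_compatible.
    pose cc a : 'rV[R]_n -> R := cst a.
    have gk : Ck k W (cc (r ^+ 2) + cc (-1) * \sum_j
       ((fun z => chart_map c (chart_inv d z) ord0 j) + cc (- y0 ord0 j)) *
       ((fun z => chart_map c (chart_inv d z) ord0 j) + cc (- y0 ord0 j))).
      apply: (CkD oW (Ck_cst _ _ oW)); apply: (CkM oW (Ck_cst _ _ oW)).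
      apply: Ck_sum => // j.
      by apply: CkM => //; exact: (CkD oW (cj j) (Ck_cst _ _ oW)).
    apply: (@eq_Ck _ _ _ _ _ _ oW _ (Ck_flat_exp 1 oW gk)) => z.
    rewrite inE => -[_ cz].
    rewrite /= /phi asboolT//; congr flat_exp.
    rewrite /g !fctE /cc /= mulN1r; congr (_ - _).
    by rewrite fct_sumE; apply: eq_bigr => j _; rewrite !fctE /= -expr2.
  exists (chart_img d `&` chart_inv d @^-1` ~` (chart_inv c @` box)).
    split=> //= -[z /boxE/rV[cz _] zy]; apply: cy; rewrite -zy.
    by move: cz => [x cx <-]; rewrite chart_mapK ?inE.
  have oW := chart_inv_preimage_open (c := d) (closed_openC cK).
  apply: (@eq_Ck _ _ _ _ _ _ oW _ (Ck_cst k 0 oW)) => z; rewrite inE => -[_ Kz].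
  by rewrite /= phi0.
exists (SmoothFun (asboolT sphi)) => /=.
  rewrite /phi asboolT// /flat_exp /g big1 => [|j _]; last first.
    by rewrite subrr expr0n.
  by rewrite subr0 exprn_gt0// hornerC mul1r gt_eqF// expR_gt0.
move=> q Uq; apply: phi0 => -[y /boxE/rV[_ Vy] yq].
by apply/Uq/VU; rewrite -yq.
Qed.

End Bump.

(** * Locality of 1-forms *)

Section Evaluation.
Context {R : realType} {n : nat} (M : smoothManifold R n).
Local Notation C := (smoothFun M).

Lemma smoothFun_eq (f g : C) : (forall p, f p = g p) -> f = g.
Proof. by move=> fg; apply: val_inj; apply/funext. Qed.

Definition evalf (p : M) (f : C) : R := f p.

Lemma evalf_is_zmod_morphism p : zmod_morphism (evalf p).
Proof. by []. Qed.

Lemma evalf_is_monoid_morphism p : monoid_morphism (evalf p).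
Proof. by []. Qed.

HB.instance Definition _ p :=
  GRing.isZmodMorphism.Build C R (evalf p) (evalf_is_zmod_morphism p).
HB.instance Definition _ p :=
  GRing.isMonoidMorphism.Build C R (evalf p) (evalf_is_monoid_morphism p).

Lemma sfun0E p : (0 : C) p = 0. Proof. exact: (rmorph0 (evalf p)). Qed.
Lemma sfunDE (f g : C) p : (f + g) p = f p + g p.
Proof. exact: (rmorphD (evalf p)). Qed.
Lemma sfunNE (f : C) p : (- f) p = - f p.
Proof. exact: (rmorphN (evalf p)). Qed.
Lemma sfunME (f g : C) p : (f * g) p = f p * g p.
Proof. exact: (rmorphM (evalf p)). Qed.
Lemma sfun_sumE (I : Type) (r : seq I) (P : pred I) (F : I -> C) p :
  (\sum_(i <- r | P i) F i) p = \sum_(i <- r | P i) F i p.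
Proof. exact: (rmorph_sum (evalf p)). Qed.
Definition sfunE := (sfun0E, sfunDE, sfunNE, sfunME, sfun_sumE).

Lemma vfield_addE (X Y : vfield M) f : (X + Y) f = X f + Y f.
Proof. by []. Qed.

Lemma vfield_oppE (X : vfield M) f : (- X) f = - X f.
Proof. by []. Qed.

Lemma vfield_scaleE (u : C) (X : vfield M) f : (u *: X) f = u * X f.
Proof. by []. Qed.

Lemma vfield_sumE (I : Type) (r : seq I) (P : pred I) (X : I -> vfield M) f :
  (\sum_(i <- r | P i) X i) f = \sum_(i <- r | P i) X i f.
Proof. exact: (big_morph (fun X : vfield M => X f)). Qed.

Lemma one_form0 (w : one_form M) : w 0 = 0.
Proof. by rewrite -(scale0r (0 : vfield M)) one_formZ mul0r. Qed.

Lemma one_formN (w : one_form M) X : w (- X) = - w X.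
Proof. by rewrite -scaleN1r one_formZ mulN1r. Qed.

Lemma one_form_sum (w : one_form M) (I : Type) (r : seq I) (P : pred I)
    (X : I -> vfield M) :
  w (\sum_(i <- r | P i) X i) = \sum_(i <- r | P i) w (X i).
Proof. by apply: (big_morph w); [exact: one_formD|exact: one_form0]. Qed.

Lemma vfield_tangent (X : vfield M) p : is_tangent_vector p (fun f => X f p).
Proof.
by split=> [a b f g|f g]; rewrite ?vfieldD ?vfieldZ ?vfieldM ?sfunE.
Qed.

Lemma tangent0 (p : M) : is_tangent_vector p (fun=> 0).
Proof. by split=> *; rewrite !mulr0 addr0. Qed.

End Evaluation.

(** * Dependence of 1-forms on point values only *)

Section Locality.
Context {R : realType} {n : nat} {M : smoothManifold R n}.
Local Notation C := (smoothFun M).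

(** A bump function [phi] supported where [V] vanishes gives [phi *: V = 0], hence
    [phi p * w V p = 0]. *)
Lemma one_form_near0 (w : one_form M) (V : vfield M) (p : M) :
  (\forall q \near p, forall f, V f q = 0) -> w V p = 0.
Proof.
move=> V0; have [phi phip phi0] := bump_exists V0.
have /(congr1 (fun X => w X p)) : phi *: V = 0.
  apply: vfield_eq => f; apply: smoothFun_eq => q.
  rewrite vfield_scaleE sfunME sfun0E.
  have [/(_ f) -> |/phi0 ->] := pselect (forall f, V f q = 0).
    by rewrite mulr0.
  by rewrite mul0r.
rewrite one_formZ one_form0 sfunE => /eqP.
by rewrite mulf_eq0 (negbTE phip) => /eqP.
Qed.

Lemma frame_free (E : 'I_n -> vfield M) (p : M) (c : 'rV[R]_n) :
  is_frame_at E p ->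
  (forall f, \sum_(i < n) c ord0 i * E i f p = 0) -> c = 0.
Proof.
move=> /(_ _ (tangent0 p))[c' [_ c'u]] c0.
rewrite -(c'u c) => [|f]; last by rewrite c0.
by apply: c'u => f; rewrite big1// => i _; rewrite mxE mul0r.
Qed.

(** The functions are chosen one by one. If no [f] enlarged the row space of the k < n rows found so
    far, a nonzero [u] orthogonal to them would satisfy sum_j u_j E_j f p = 0 for all [f], against
    freeness of the frame. *)
Lemma frame_dual_functions (E : 'I_n -> vfield M) (p : M) :
  is_frame_at E p ->
  exists F : 'I_n -> C, \det (\matrix_(k, j) E j (F k) p) != 0.
Proof.
move=> Ep.
suff H k : (k <= n)%N ->
    exists F : 'I_k -> C, row_free (\matrix_(i < k, j < n) E j (F i) p).
  have [F Fp] := H n (leqnn n); exists F.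
  by rewrite -unitfE -unitmxE -row_free_unit.
elim: k => [|k IH] kn.
  exists (fun=> 0); apply: inj_row_free => v _; exact: thinmx0.
have [F Ff] := IH (ltnW kn).
set B := \matrix_(_, _) _ in Ff.
have [f fB] : exists f, ~~ (\row_j E j f p <= B)%MS.
  apply: contrapT => /forallNP noF.
  have /rowV0Pn[u uB u0] : kermx B^T != 0.
    by rewrite kermx_eq0 /row_free mxrank_tr (eqP Ff) ltn_eqF.
  move/sub_kermxP: uB => uB; case/eqP: u0.
  apply: (frame_free Ep) => f.
  have /negP := noF f; rewrite negbK => /submxP[D fD].
  have /matrixP/(_ ord0 ord0) : u *m (\row_j E j f p)^T = 0.
    by rewrite fD trmx_mul mulmxA uB mul0mx.
  by rewrite !mxE; under eq_bigr do rewrite !mxE.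
exists (fun i => if unlift ord0 i is Some j then F j else f).
apply: inj_row_free => v /matrixP vA.
pose v' := \row_i v ord0 (lift ord0 i).
have vE j : v ord0 ord0 * E j f p + (v' *m B) ord0 j = 0.
  have := vA ord0 j; rewrite !mxE big_ord_recl !mxE unlift_none => vj0.
  rewrite -[RHS]vj0; congr (_ + _).
  by apply: eq_bigr => i _; rewrite !mxE liftK.
have v0 : v ord0 ord0 = 0.
  apply/eqP; apply: contraNT fB => v0.
  apply/submxP; exists (- (v ord0 ord0)^-1 *: v').
  apply/rowP => j; rewrite mxE -scalemxAl [RHS]mxE.
  have /eqP := vE j; rewrite addrC addr_eq0 => /eqP ->.
  by rewrite mulrNN mulKf.
have /(row_free_inj Ff) : v' *m B = 0 *m B.
  by apply/rowP => j; rewrite mul0mx [RHS]mxE -(vE j) v0 mul0r add0r.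
move=> /rowP v'0; apply/rowP => i; rewrite [RHS]mxE.
have [j ->|->//] := unliftP ord0 i.
by have := v'0 j; rewrite !mxE.
Qed.

(** With A = (E_j F_k) and d = det A, Cramer's rule writes [d *: V] near [p] as a combination of the
    frame. Its coefficients [g j] are global smooth functions, as nothing is divided by [d], and
    they vanish at [p] with [V]. *)
Lemma one_form_at (w : one_form M) (E : 'I_n -> vfield M) (V : vfield M)
    (p : M) :
  (\forall q \near p, is_frame_at E q) -> (forall f, V f p = 0) -> w V p = 0.
Proof.
move=> En V0.
have [F Fp] := frame_dual_functions (nbhs_singleton En).
pose A : 'M[C]_n := \matrix_(k, j) E j (F k).
have [d [dp adjA]] : exists d : C, d p != 0 /\ \adj A *m A = d%:M.
  exists (\det A); split; last exact: mul_adj_mx.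
  rewrite -[\det A p]/(evalf p (\det A)) -det_map_mx.
  congr (\det _ != 0): Fp.
  by apply/matrixP => i j; rewrite !mxE.
pose g j := \sum_k (\adj A) j k * V (F k).
have : w (d *: V - \sum_j g j *: E j) p = 0.
  (* At [q] the components [c] of [V] satisfy V F_k = sum_l c_l E_l F_k, so the adjugate yields
     [g j q = d q * c ord0 j]. *)
  apply: one_form_near0; apply: filterS En => q Eq f.
  have [c [Vc _]] := Eq _ (vfield_tangent V q).
  have gE j : g j q = d q * c ord0 j.
    rewrite /g sfunE.
    under eq_bigr do rewrite sfunE Vc mulr_sumr.
    rewrite exchange_big/=.
    under eq_bigr => l _ do under eq_bigr => k _ do rewrite mulrCA.
    under eq_bigr => l _ do rewrite -mulr_sumr.
    have Ad l : \sum_k (\adj A) j k q * E l (F k) q = (d q) *+ (j == l).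
      have /matrixP/(_ j l)/(congr1 (evalf q)) := adjA.
      rewrite !mxE rmorphMn rmorph_sum/= => <-.
      by apply: eq_bigr => k _; rewrite -sfunME [A _ _]mxE.
    rewrite (bigD1 j)//= Ad eqxx mulr1n big1 => [|l lj]; last first.
      by rewrite Ad eq_sym (negbTE lj) mulr0.
    by rewrite addr0 mulrC.
  rewrite vfield_addE vfield_oppE vfield_scaleE vfield_sumE !sfunE Vc.
  rewrite mulr_sumr; apply/eqP; rewrite subr_eq0; apply/eqP.
  by apply: eq_bigr => j _; rewrite vfield_scaleE sfunME gE mulrA.
rewrite one_formD one_formN one_formZ one_form_sum !sfunE big1 => [|j _].
  by rewrite subr0 => /eqP; rewrite mulf_eq0 (negbTE dp) => /eqP.
rewrite one_formZ sfunE sfun_sumE big1 ?mul0r// => k _.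
by rewrite sfunE V0 mulr0.
Qed.

End Locality.

(** * The musical isomorphism *)

Section Gluing.
Context {R : realType} {n : nat} {M : smoothManifold R n}.
Local Notation C := (smoothFun M).

Lemma smooth_local (f : M -> R) :
  (forall p : M, exists g : C, \forall q \near p, f q = g q) -> smooth f.
Proof.
move=> fg c cA k; apply: Ck_nbhs => y cy.
(* Passing to the interior makes the set of agreement open, as [eq_Ck] requires. *)
have [g /nbhs_interior gf] := fg (chart_inv c y).
exists (chart_img c `&` chart_inv c @^-1` [set q | f q = g q]°).
  by split=> //; exact: nbhs_singleton gf.
have oW := chart_inv_preimage_open (c := c) (open_interior [set q | f q = g q]).
have /asboolP gs := smoothFunP g.
apply: (@eq_Ck _ _ _ _ (g \o chart_inv c) _ oW).
  by move=> z; rewrite inE => -[_ /interior_subset].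
apply: Ck_nbhs => z [cz _]; exists (chart_img c) => //.
exact: gs.
Qed.

Lemma one_form_frameE (w : one_form M) (E : 'I_n -> vfield M) (V : vfield M)
    (p : M) (c : 'rV[R]_n) :
  (\forall q \near p, is_frame_at E q) ->
  (forall f, V f p = \sum_(i < n) c ord0 i * E i f p) ->
  w V p = \sum_(i < n) c ord0 i * w (E i) p.
Proof.
move=> En Vc.
have : w (V - \sum_i constf M (c ord0 i) *: E i) p = 0.
  apply: (one_form_at _ En) => f.
  rewrite vfield_addE vfield_oppE vfield_sumE !sfunE Vc.
  apply/eqP; rewrite subr_eq0; apply/eqP.
  by apply: eq_bigr => i _; rewrite vfield_scaleE sfunME.
rewrite one_formD one_formN one_form_sum !sfunE => /eqP.
rewrite subr_eq0 => /eqP ->.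
by apply: eq_bigr => i _; rewrite one_formZ sfunME.
Qed.

End Gluing.

Section Musical.
Context {R : realType} {n : nat} {M : smoothManifold R n}.
Local Notation C := (smoothFun M).
Variable h : tensor02 M.

Lemma flatD X Y : flat h (X + Y) = flat h X + flat h Y.
Proof. apply: one_form_eq => V; exact: (tensor02_linearl h V).1. Qed.

Lemma flatZ u X : flat h (u *: X) = u *: flat h X.
Proof. apply: one_form_eq => V; exact: (tensor02_linearl h V).2. Qed.

Lemma flatN X : flat h (- X) = - flat h X.
Proof. by rewrite -!scaleN1r flatZ. Qed.

(** The coefficients are frozen at [q], so only the value at [q] matters. The factors h(E_j, E_j)
    are the signs of a possibly indefinite [h]. *)
Definition frame_sharp (E : 'I_n -> vfield M) (w : one_form M) (q : M) :
    vfield M :=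
  \sum_j constf M (h (E j) (E j) q * w (E j) q) *: E j.

Lemma frame_sharpE (E : 'I_n -> vfield M) (w : one_form M) (q : M)
    (V : vfield M) :
  (\forall q' \near q, is_frame_at E q') -> orthonormal_at h E q ->
  h (frame_sharp E w q) V q = w V q.
Proof.
move=> En Eo.
have [c [Vc _]] := nbhs_singleton En _ (vfield_tangent V q).
rewrite -[h _ V]/(flat h (frame_sharp E w q) V).
rewrite !(one_form_frameE _ En Vc); apply: eq_bigr => k _; congr (_ * _).
(* Fixing the second argument of [h] gives a 1-form in the first, so the sum can be expanded. *)
have -> : flat h (frame_sharp E w q) (E k) =
    OneForm (tensor02_linearl h (E k)) (frame_sharp E w q) by [].
rewrite one_form_sum sfun_sumE (bigD1 k)// big1 => [|j jk].
  rewrite one_formZ sfunME /= mulrAC -expr2 -real_normK ?num_real//.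
  by rewrite Eo eqxx expr1n mul1r addr0.
rewrite one_formZ sfunME /=.
have /eqP := Eo j k; rewrite (negbTE jk) normr_eq0 => /eqP ->.
by rewrite mulr0.
Qed.

Hypothesis h_nondegenerate : tensor_nondegenerate h.

Lemma flat_inj : injective (flat h).
Proof.
move=> X Y XY; apply/eqP; rewrite -subr_eq0; apply/eqP.
apply: vfield_eq => f; apply: smoothFun_eq => p.
rewrite sfun0E; apply: h_nondegenerate => V.
by rewrite -[h _ V]/(flat h (X - Y) V) flatD flatN XY subrr.
Qed.

Variables (E : M -> 'I_n -> vfield M).
Hypothesis (E_orthonormal : orthonormal_frame_field h E).

Lemma flat_surj (w : one_form M) : exists X, flat h X = w.
Proof.
pose L q := frame_sharp (E q) w q.
(* By non-degeneracy the value at [q] is determined by its pairings with all [V], so the frames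
   [E q] and [E p] give the same one. *)
have Lnear (p : M) :
    \forall q \near p, forall f, L q f q = frame_sharp (E p) w q f q.
  have Ep := nbhs_interior (E_orthonormal p); near=> q.
  have Eq : \forall q' \near q,
      is_frame_at (E p) q' /\ orthonormal_at h (E p) q' by near: q.
  have Eqq := E_orthonormal q.
  have LE V : h (L q) V q = w V q.
    apply: frame_sharpE; first by apply: filterS Eqq => ? [].
    by have [] := nbhs_singleton Eqq.
  have pE V : h (frame_sharp (E p) w q) V q = w V q.
    apply: frame_sharpE; first by apply: filterS Eq => ? [].
    by have [] := nbhs_singleton Eq.
  move=> f; apply/eqP; rewrite -subr_eq0; apply/eqP.
  have : (L q - frame_sharp (E p) w q) f q = 0.
    apply: h_nondegenerate => V.
    rewrite -[h _ V]/(flat h (L q - frame_sharp (E p) w q) V) flatD flatN.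
    rewrite -[LHS]/((h (L q) V - h (frame_sharp (E p) w q) V) q).
    by rewrite sfunDE sfunNE LE pE subrr.
  by rewrite vfield_addE vfield_oppE !sfunE.
(* Near [p] the single frame [E p] serves for all [q], and its coefficients are smooth functions. *)
have Ls f : smooth (fun q => L q f q).
  apply: smooth_local => p.
  exists (\sum_j h (E p j) (E p j) * w (E p j) * E p j f).
  apply: filterS (Lnear p) => q ->.
  rewrite /frame_sharp vfield_sumE !sfun_sumE; apply: eq_bigr => j _.
  by rewrite vfield_scaleE !sfunME.
pose X f : C := SmoothFun (asboolT (Ls f)).
have XD : derivation X.
  split=> [f g|a f|f g]; apply: smoothFun_eq => q.
  - by rewrite sfunDE /= vfieldD sfunDE.
  - by rewrite sfunME /= vfieldZ sfunME.
  - by rewrite sfunDE !sfunME /= vfieldM sfunDE !sfunME.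
exists (VField XD); apply: one_form_eq => V; apply: smoothFun_eq => q.
have Eq : \forall q' \near q, is_frame_at (E q) q'.
  by apply: filterS (E_orthonormal q) => ? [].
rewrite -(@frame_sharpE (E q) w q V)//; last first.
  by have [] := nbhs_singleton (E_orthonormal q).
(* The glued field and [L q] have the same value at [q], hence the same pairing with [V] there. *)
have := @one_form_at _ _ _ (OneForm (tensor02_linearl h V)) _
  (VField XD - L q) q Eq.
rewrite one_formD one_formN sfunDE sfunNE => /(_ _)/eqP.
rewrite subr_eq0 => H; apply/eqP/H => f.
by rewrite vfield_addE vfield_oppE sfunDE sfunNE subrr.
Unshelve. all: by end_near. Qed.

Lemma sharpK w : flat h (sharp h w) = w.
Proof. exact: (xgetPex 0 (flat_surj w)). Qed.

Lemma flatK X : sharp h (flat h X) = X.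
Proof. by apply: flat_inj; rewrite sharpK. Qed.

End Musical.

(** * The curvature of the alpha-connection *)

Section ConnectionAlgebra.
Context {R : realType} {n : nat} {M : smoothManifold R n}.
Variable nabla : affine_connection M.

Lemma vfield_constf (X : vfield M) a : X (constf M a) = 0.
Proof.
(* The Leibniz rule on 1 * 1 gives X 1 = X 1 + X 1. *)
have X1 : X 1 = 0.
  have := vfieldM X 1 1; rewrite !mul1r => /eqP.
  by rewrite addrC -subr_eq subrr eq_sym => /eqP.
by rewrite -[constf M a]mulr1 vfieldZ X1 mulr0.
Qed.

Lemma connection_constf X a Y :
  nabla X (constf M a *: Y) = constf M a *: nabla X Y.
Proof. by rewrite connectionZr vfield_constf scale0r add0r. Qed.

Lemma connectionNl X Y : nabla (- X) Y = - nabla X Y.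
Proof. by rewrite -!scaleN1r connectionZl. Qed.

Lemma nablaFD X (w z : one_form M) :
  nablaF nabla X (w + z) = nablaF nabla X w + nablaF nabla X z.
Proof.
apply: one_form_eq => V.
rewrite -[LHS]/(X (w V + z V) - (w (nabla X V) + z (nabla X V))).
by rewrite vfieldD opprD addrACA.
Qed.

Lemma nablaF_constf X a (w : one_form M) :
  nablaF nabla X (constf M a *: w) = constf M a *: nablaF nabla X w.
Proof.
apply: one_form_eq => V.
rewrite -[LHS]/(X (constf M a * w V) - constf M a * w (nabla X V)).
by rewrite vfieldZ -mulrBr.
Qed.

Lemma nablaFNl X (w : one_form M) : nablaF nabla (- X) w = - nablaF nabla X w.
Proof.
apply: one_form_eq => V.
rewrite -[LHS]/(- X (w V) - w (nabla (- X) V)) connectionNl one_formN.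
by rewrite -opprD.
Qed.

Lemma lieC (X Y : vfield M) : lie X Y = - lie Y X.
Proof.
apply: vfield_eq => f; rewrite vfield_oppE.
by rewrite -[LHS]/(X (Y f) - Y (X f)) -opprB.
Qed.

End ConnectionAlgebra.

(** The cotangent contributions are opposite for [flat h X] and [- flat h X] and cancel. *)
Lemma gmetric_flat_pair {R : realType} {n : nat} {M : smoothManifold R n}
    (h : tensor02 M) (K : gsection M) (X : vfield M) (p : M) :
  cancel (flat h) (sharp h) ->
  (gmetric h K (X, flat h X) + gmetric h K (X, - flat h X)) p =
  h K.1 X p *+ 2.
Proof.
move=> flatK; have gE w : gmetric h K (X, w) p =
    h K.1 X p + h (sharp h K.2) (sharp h w) p by rewrite -sfunDE.
rewrite sfunDE !gE -flatN !flatK.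
have -> : h (sharp h K.2) (- X) = - h (sharp h K.2) X.
  exact: (one_formN (flat h (sharp h K.2))).
by rewrite sfunNE addrACA subrr addr0 mulr2n.
Qed.

(** * The tangent component of the curvature *)

Section AlphaConnection.
Context {R : realType} {n : nat} {M : smoothManifold R n}.
Variables (nabla : affine_connection M) (h : tensor02 M).
Hypothesis sharpK : forall w, flat h (sharp h w) = w.
Variable alpha : R.
Local Notation a := ((1 + alpha) / 2).
Local Notation b := ((1 - alpha) / 2).
Local Notation D := (alpha_conn alpha (gconn h nabla) (gconn_dual h nabla)).

Definition tangent_alpha (X Y : vfield M) : vfield M :=
  constf M a *: nabla X Y + constf M b *: sharp h (nablaF nabla X (flat h Y)).

Lemma gcurv_alpha_tangent (s t v : gsection M) :
  (gcurv nabla D s t v).1 = curvature (@lie _ _ M) tangent_alpha s.1 t.1 v.1.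
Proof. by []. Qed.

(** The alpha-connection differentiates only along the tangent part of its direction, also in the
    bracket term. Hence both frame vectors over the same [E i] have the same curvature. *)
Lemma gcurv_alpha_fst (s s' t v : gsection M) : s.1 = s'.1 ->
  gcurv nabla D s t v = gcurv nabla D s' t v.
Proof. by case: s s' => [X w] [X' w'] /= ->. Qed.

Lemma flat_tangent_alpha X Y : flat h (tangent_alpha X Y) =
  constf M a *: flat h (nabla X Y) + constf M b *: nablaF nabla X (flat h Y).
Proof. by rewrite flatD !flatZ sharpK. Qed.

Lemma flat_tangent_alpha2 X Y Z : flat h (tangent_alpha X (tangent_alpha Y Z)) =
  constf M a *: (constf M a *: flat h (nabla X (nabla Y Z)) +
    constf M b *: flat h (nabla X (sharp h (nablaF nabla Y (flat h Z))))) +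
  constf M b *: (constf M a *: nablaF nabla X (flat h (nabla Y Z)) +
    constf M b *: nablaF nabla X (nablaF nabla Y (flat h Z))).
Proof.
rewrite flat_tangent_alpha; congr (_ *: _ + _ *: _).
  by rewrite connectionDr !connection_constf flatD !flatZ.
by rewrite flat_tangent_alpha nablaFD !nablaF_constf.
Qed.

(** Second-order terms carry a^2, b^2 or ab = (1 - alpha^2)/4. Since a + b = 1, the bracket term
    splits into parts completing the two curvatures and a remainder with factor ab. *)
Lemma curvature_tangent_alpha X Y Z V p :
  h (curvature (@lie _ _ M) tangent_alpha X Y Z) V p =
  a ^+ 2 * h (curv nabla X Y Z) V p
  + b ^+ 2 * curvF nabla X Y (flat h Z) V p
  + (1 - alpha ^+ 2) / 4 *
    ( nablaF nabla (lie Y X) (flat h Z) V p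
    - nablaF nabla Y (flat h (nabla X Z)) V p
    + nablaF nabla X (flat h (nabla Y Z)) V p
    + h (nabla (lie Y X) Z) V p
    - h (nabla Y (sharp h (nablaF nabla X (flat h Z)))) V p
    + h (nabla X (sharp h (nablaF nabla Y (flat h Z)))) V p).
Proof.
have hE X' : h X' V p = flat h X' V p by [].
have flatBB A B C : flat h (A - B - C) = flat h A - flat h B - flat h C.
  by rewrite !flatD !flatN.
rewrite !hE /curv /curvF /curvature !flatBB.
(* Reversing the bracket matches the mixed terms, stated with [lie Y X], to those coming from the
   curvature. *)
rewrite !flat_tangent_alpha2 flat_tangent_alpha (lieC Y X).
rewrite connectionNl nablaFNl flatN.
have addE (w z : one_form M) : (w + z) V p = w V p + z V p.
  by rewrite -sfunDE.
have oppE (w : one_form M) : (- w) V p = - w V p by rewrite -sfunNE.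
have scaleE c (w : one_form M) : (constf M c *: w) V p = c * w V p.
  by rewrite -[LHS]/((constf M c * w V) p) sfunME.
rewrite !(addE, oppE, scaleE).
by field.
Qed.

End AlphaConnection.

(** * Summation over the frame *)

Theorem proposition3p15 (R : realType) (n : nat) (M : smoothManifold R n)
    (nabla : affine_connection M) (h : tensor02 M)
    (h_nondegenerate : tensor_nondegenerate h)
    (alpha : R)
    (E : M -> 'I_n -> vfield M) (E_orthonormal : orthonormal_frame_field h E)
    (h_symmetric : tensor_symmetric h)
    (Y Z : vfield M) (beta gamma : one_form M) (p : M) :
  let nabla_alpha := alpha_conn alpha (gconn h nabla) (gconn_dual h nabla) in
  gricci h nabla nabla_alpha (E p) (Y, beta) (Z, gamma) p
  = ((1 + alpha) / 2) ^+ 2 * ricci h nabla (E p) Y Z p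
  + ((1 - alpha) / 2) ^+ 2 *
      (\sum_(i < n) curvF nabla (E p i) Y (flat h Z) (E p i) p)
  + (1 - alpha ^+ 2) / 4 *
      \sum_(i < n)
        ( nablaF nabla (lie Y (E p i)) (flat h Z) (E p i) p
        - nablaF nabla Y (flat h (nabla (E p i) Z)) (E p i) p
        + nablaF nabla (E p i) (flat h (nabla Y Z)) (E p i) p
        + h (nabla (lie Y (E p i)) Z) (E p i) p
        - h (nabla Y (sharp h (nablaF nabla (E p i) (flat h Z)))) (E p i) p
        + h (nabla (E p i) (sharp h (nablaF nabla Y (flat h Z)))) (E p i) p).
Proof.
move=> D.
have hK w : flat h (sharp h w) = w by exact: sharpK E_orthonormal w.
have hK' X : sharp h (flat h X) = X by exact: flatK E_orthonormal X.
rewrite /ricci !sfun_sumE !mulr_sumr -!big_split /gricci.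
rewrite sfunME sfun_sumE mulr_sumr; apply: eq_bigr => i _.
transitivity (h (curvature (@lie _ _ M) (tangent_alpha nabla h alpha)
  (E p i) Y Z) (E p i) p); last exact: curvature_tangent_alpha.
rewrite (gcurv_alpha_fst _ _ _ (s := (E p i, - flat h (E p i)))
  (s' := (E p i, flat h (E p i)))) //.
rewrite gmetric_flat_pair// gcurv_alpha_tangent.
(* The 1/2 in [gricci] cancels the two equal contributions of each frame pair. *)
by rewrite -[constf M _ _]/(2^-1 : R); field.
Qed.
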